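(* For any first-order algorithm $\mathcal A$ in the zero-respecting class (defined in the context) that runs for $T$ iterations and any initial point $x_0$, there exist a $(1,1)$-Lipschitz instance of the simple bilevel problem and some adversarial subgradients $\{\partial f(x_k),\partial g(x_k)\}_{k=0}^{T-1}$ such that the optimal solution $x^*$ satisfies $\|x_0-x^*\|_2\le 1$ and $|f(x_0)-f^*|\ge\frac14$. For the iterates $\{x_k\}_{k=0}^T$ generated by $\mathcal A$, the following holds: $$f(x_k)=f(x_0),\qquad \forall\,1\le k\le T.$$
   Context: Simple bilevel problem: minimize $f(x)$ over $x\in \mathcal X_g^*:=\arg\min_{z\in\mathcal Z} g(z)$, where $f,g:\mathbb R^n\to\mathbb R$ are convex and continuous and $\mathcal Z\subseteq\mathbb R^n$ is convex and compact. Its optimal value is $f^*$. An instance consists of $n$, $f$, $g$ and $\mathcal Z$ (so the dimension is part of the instance and may depend on $T$). The instance is $(C_f,C_g)$-Lipschitz if $f$ is $C_f$-Lipschitz on $\mathcal Z$ and $g$ is $C_g$-Lipschitz on $\mathcal Z$ (Euclidean norm). For $x\in\mathbb R^n$ write $x_{[j]}$ for its $j$-th coordinate and $\mathrm{supp}(x)=\{j: x_{[j]}\neq 0\}$. Zero-respecting class: an iterative method $\mathcal A$ can access $f$ and $g$ only through a first-order black-box oracle, which takes a test point $\hat x$ as input and returns $\partial f(\hat x),\partial g(\hat x)$, where these symbols denote single arbitrary subgradients of $f$ and $g$ at $\hat x$ (possibly chosen adversarially by the oracle). $\mathcal A$ generates a sequence of test points $x_0,x_1,x_2,\dots$ with $$\mathrm{supp}(x_{k+1})\subseteq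 \mathrm{supp}(x_0)\cup\left(\bigcup_{0\le s\le k}\mathrm{supp}(\partial f(x_s))\cup\mathrm{supp}(\partial g(x_s))\right).$$ *)

(* Defs.v *)
From HB Require Import structures.
From mathcomp Require Import all_boot all_order all_algebra.
From mathcomp Require Import all_classical all_reals topology normedtype convex.

Set Implicit Arguments.
Unset Strict Implicit.
Unset Printing Implicit Defensive.

Import Order.TTheory GRing.Theory Num.Theory.
Import numFieldNormedType.Exports.

Local Open Scope classical_set_scope.
Local Open Scope ring_scope.

Definition dot (R : realType) (n : nat) (x y : 'rV[R]_n) : R :=
  \sum_(j < n) x 0 j * y 0 j.

(* The library norm `|x| on 'rV[R]_n is the sup norm; its topology, which
   [continuous] and [compact] below refer to, is the Euclidean one. *)
Definition enorm (R : realType) (n : nat) (x : 'rV[R]_n) : R :=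
  Num.sqrt (dot x x).

Definition supp (R : realType) (n : nat) (x : 'rV[R]_n) : {set 'I_n} :=
  [set j | x 0 j != 0]%SET.

Definition argmin (R : realType) (T : Type) (D : set T) (h : T -> R) : set T :=
  [set x | D x /\ forall z, D z -> h x <= h z].

Definition subgradient (R : realType) (n : nat) (h : 'rV[R]_n -> R)
    (x v : 'rV[R]_n) : Prop :=
  forall y, h x + dot v (y - x) <= h y.

Definition lipschitz_over (R : realType) (n : nat) (C : R) (Z : set 'rV[R]_n)
    (h : 'rV[R]_n -> R) : Prop :=
  forall x y, Z x -> Z y -> `|h x - h y| <= C * enorm (x - y).

(* The simple bilevel problem: minimize [upper_obj] over the minimizers of
   [lower_obj] on [feas]. *)
Record bilevel (R : realType) := Bilevel {
  ndim : nat;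
  upper_obj : 'rV[R]_ndim -> R;
  lower_obj : 'rV[R]_ndim -> R;
  feas : set 'rV[R]_ndim;
  upper_convex : convex_function setT upper_obj;
  upper_continuous : continuous upper_obj;
  lower_convex : convex_function setT lower_obj;
  lower_continuous : continuous lower_obj;
  feas_convex : convex_set feas;
  feas_compact : compact feas
}.

Arguments upper_obj {R} b x.
Arguments lower_obj {R} b x.
Arguments feas {R} b _.

Definition lower_solutions (R : realType) (P : bilevel R) :
    set 'rV[R]_(ndim P) :=
  argmin (feas P) (lower_obj P).

Arguments lower_solutions {R} P _.

Definition optimal_solutions (R : realType) (P : bilevel R) :
    set 'rV[R]_(ndim P) :=
  argmin (lower_solutions P) (upper_obj P).

Arguments optimal_solutions {R} P _.

Definition optimal_value (R : realType) (P : bilevel R) : R :=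
  inf (upper_obj P @` lower_solutions P).

Definition lipschitz_instance (R : realType) (Cf Cg : R)
    (P : bilevel R) : Prop :=
  lipschitz_over Cf (feas P) (upper_obj P) /\
  lipschitz_over Cg (feas P) (lower_obj P).

(* [(O x).1] and [(O x).2] are the subgradients of the upper- and lower-level
   objectives that the oracle returns at the test point [x]. *)
Definition is_oracle (R : realType) (P : bilevel R)
    (O : 'rV[R]_(ndim P) -> 'rV[R]_(ndim P) * 'rV[R]_(ndim P)) : Prop :=
  forall x, subgradient (upper_obj P) x (O x).1 /\
            subgradient (lower_obj P) x (O x).2.

(* A method maps the dimension, the feasible set, the initial point and the
   nonempty list of oracle answers received so far (oldest first) to the next
   test point.  The earlier test points can be recomputed from these data. *)
Definition algorithm (R : realType) : Type :=
  forall n : nat, set 'rV[R]_n -> 'rV[R]_n -> seq ('rV[R]_n * 'rV[R]_n) ->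
  'rV[R]_n.

Definition test_point (R : realType) (A : algorithm R) (n : nat)
    (Z : set 'rV[R]_n) (x0 : 'rV[R]_n) (h : seq ('rV[R]_n * 'rV[R]_n)) :
    'rV[R]_n :=
  if nilp h then x0 else A n Z x0 h.

(* The answers of [O] at the test points x_0, ..., x_(k-1) *)
Fixpoint answers (R : realType) (A : algorithm R) (n : nat) (Z : set 'rV[R]_n)
    (x0 : 'rV[R]_n) (O : 'rV[R]_n -> 'rV[R]_n * 'rV[R]_n) (k : nat) :
    seq ('rV[R]_n * 'rV[R]_n) :=
  if k is k'.+1 then
    let h := answers A Z x0 O k' in rcons h (O (test_point A Z x0 h))
  else [::].

Definition iterate (R : realType) (A : algorithm R) (P : bilevel R)
    (x0 : 'rV[R]_(ndim P))
    (O : 'rV[R]_(ndim P) -> 'rV[R]_(ndim P) * 'rV[R]_(ndim P))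
    (k : nat) :
    'rV[R]_(ndim P) :=
  test_point A (feas P) x0 (answers A (feas P) x0 O k).

Definition zero_respecting (R : realType) (A : algorithm R) : Prop :=
  forall (P : bilevel R) (x0 : 'rV[R]_(ndim P))
         (O : 'rV[R]_(ndim P) -> 'rV[R]_(ndim P) * 'rV[R]_(ndim P)),
    is_oracle O ->
    forall k : nat,
      let x := iterate A x0 O in
      supp (x k.+1) \subset
        (supp (x 0%N) :|:
         \bigcup_(s < k.+1) (supp (O (x s)).1 :|: supp (O (x s)).2))%SET.

(* Main.v *)
(* A resisting oracle defeats every deterministic method, so any [x0] will do.
   With orthonormal directions v_0, ..., v_T, put f x = max(0, <v_T, x - x0>)
   and g x = max_j (- c_j <v_j, x - x0>) on a Euclidean ball about x0.  As long
   as the test points see only zeros along the directions still to come, f is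
   flat there and g returns one of the directions already fixed; the next one is
   then chosen orthogonal to everything seen so far.  Since v_T is orthogonal to
   x_k - x0 for all k <= T, f never moves, whereas the minimizer of g over the
   ball is x0 + sum_j a_j v_j with c_j a_j constant, and c_T is taken small
   enough to make a_T = 1/2. *)
Require Import Defs.
From mathcomp Require Import all_boot all_order all_algebra.
From mathcomp Require Import all_classical all_reals topology normedtype convex.
From mathcomp Require Import unstable interval_inference lra ring.
Import Order.TTheory GRing.Theory Num.Theory.
Import numFieldNormedType.Exports.
Local Open Scope classical_set_scope.
Local Open Scope ring_scope.

(** * Euclidean inner product and norm *)

Section Dot.
Context {R : realType} {n : nat}.
Implicit Types (u v w : 'rV[R]_n) (a : R).

Lemma dotC u v : dot u v = dot v u.
Proof. by apply: eq_bigr => j _; rewrite mulrC. Qed.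

Lemma dotDr u v w : dot u (v + w) = dot u v + dot u w.
Proof. by rewrite -big_split; apply: eq_bigr => j _; rewrite !mxE mulrDr. Qed.

Lemma dotZr a u v : dot u (a *: v) = a * dot u v.
Proof. by rewrite mulr_sumr; apply: eq_bigr => j _; rewrite !mxE mulrCA. Qed.

Lemma dotNr u v : dot u (- v) = - dot u v.
Proof. by rewrite -scaleN1r dotZr mulN1r. Qed.

Lemma dotBr u v w : dot u (v - w) = dot u v - dot u w.
Proof. by rewrite dotDr dotNr. Qed.

Lemma dotDl u v w : dot (v + w) u = dot v u + dot w u.
Proof. by rewrite !(dotC _ u) dotDr. Qed.

Lemma dotZl a u v : dot (a *: v) u = a * dot v u.
Proof. by rewrite !(dotC _ u) dotZr. Qed.

Lemma dotNl u v : dot (- v) u = - dot v u.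
Proof. by rewrite !(dotC _ u) dotNr. Qed.

Lemma dotBl u v w : dot (v - w) u = dot v u - dot w u.
Proof. by rewrite !(dotC _ u) dotBr. Qed.

Lemma dot0r u : dot u 0 = 0.
Proof. by rewrite -(scale0r 0) dotZr mul0r. Qed.

Lemma dot0l u : dot 0 u = 0.
Proof. by rewrite dotC dot0r. Qed.

Lemma dot_sumr (I : finType) (F : I -> 'rV[R]_n) u :
  dot u (\sum_i F i) = \sum_i dot u (F i).
Proof. by apply: (big_morph _ (dotDr u) (dot0r u)). Qed.

Lemma dot_ge0 u : 0 <= dot u u.
Proof. by apply: sumr_ge0 => j _; rewrite -expr2 sqr_ge0. Qed.

Lemma sqr_coord_le_dot u j : u 0 j ^+ 2 <= dot u u.
Proof.
rewrite /dot (bigD1 j) //= expr2 lerDl.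
by apply: sumr_ge0 => i _; rewrite -expr2 sqr_ge0.
Qed.

Lemma dot_eq0 u : dot u u <= 0 -> u = 0.
Proof.
move=> u0; apply/rowP => j; rewrite mxE; apply/eqP; rewrite -sqrf_eq0.
by rewrite eq_le sqr_ge0 (le_trans (sqr_coord_le_dot u j)).
Qed.

(** Cauchy-Schwarz for [v] in the unit ball: the residual [u - dot v u *: v] has nonnegative squared
    norm. *)
Lemma normr_dot_le_enorm v u : dot v v <= 1 -> `|dot v u| <= enorm u.
Proof.
move=> v1; rewrite -sqrtr_sqr ler_sqrt ?dot_ge0//.
have := dot_ge0 (u - dot v u *: v).
rewrite dotBl !dotBr !dotZl !dotZr (dotC u v).
have := sqr_ge0 (dot v u); nra.
Qed.

Lemma enormN u : enorm (- u) = enorm u.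
Proof. by rewrite /enorm dotNl dotNr opprK. Qed.

Lemma continuous_dotB (x0 : 'rV[R]_n) :
  continuous (fun x : 'rV[R]_n => dot (x - x0) (x - x0)).
Proof.
rewrite /dot; apply: (@continuous_big _ _ +%R 0) => [|j _ x].
  exact: add_continuous.
have cj : continuous_at x (fun y : 'rV[R]_n => (y - x0) 0 j).
  under eq_fun do rewrite 2!mxE.
  by apply: continuousB; [exact: coord_continuous|exact: cst_continuous].
exact: continuousM.
Qed.

End Dot.

(* The row kernel of the transpose of [M] is nontrivial when [m < n]. *)
Lemma exists_unit_orthogonal (R : realType) m n (M : 'M[R]_(m, n)) :
  (m < n)%N ->
  exists2 u : 'rV[R]_n, dot u u = 1 & forall i, dot u (row i M) = 0.
Proof.
move=> mn.
have : kermx M^T != 0.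
  rewrite -mxrank_eq0 mxrank_ker mxrank_tr subn_eq0 -ltnNge.
  exact: leq_ltn_trans (rank_leq_row M) mn.
case/rowV0Pn => w /sub_kermxP wM w0.
have ww : 0 < dot w w.
  rewrite lt_neqAle dot_ge0 andbT eq_sym; apply: contra w0 => /eqP ww.
  by apply/eqP/dot_eq0; rewrite ww.
exists ((Num.sqrt (dot w w))^-1 *: w) => [|i].
  rewrite dotZl dotZr mulrA -invfM -expr2 sqr_sqrtr ?dot_ge0// mulVf//.
  by rewrite gt_eqF.
rewrite dotZl; have -> : dot w (row i M) = (w *m M^T) 0 i.
  by rewrite mxE; apply: eq_bigr => j _; rewrite !mxE.
by rewrite wM mxE mulr0.
Qed.

(** * Convexity and Lipschitz continuity from subgradients *)

Section Subgradient.
Context {R : realType} {n : nat} (h : 'rV[R]_n -> R).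

(** Weight the subgradient inequalities from the convex combination [z] to [x] and to [y]; the
    linear terms cancel. *)
Lemma subgradient_convex :
  (forall x, exists v, subgradient h x v) -> convex_function setT h.
Proof.
move=> hs t x y _ _; rewrite convRE.
set z := conv t x y.
have zE : z = t%:num *: (x : 'rV[R]_n) + (1 - t%:num) *: (y : 'rV[R]_n) by [].
have [v hv] := hs z.
have hx := hv x; have hy := hv y.
have t0 : 0 <= t%:num by [].
have t1 : t%:num <= 1 by [].
have dz : t%:num * dot v (x - z) + (1 - t%:num) * dot v (y - z) = 0.
  rewrite !dotBr zE dotDr !dotZr; ring.
rewrite /onem; change (h z <= t%:num * h x + (1 - t%:num) * h y).
nra.
Qed.

Lemma subgradient_lipschitz Z :
  (forall x, exists2 v, subgradient h x v & dot v v <= 1) ->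
  lipschitz_over 1 Z h.
Proof.
move=> hs x y _ _; rewrite mul1r.
have [v hv v1] := hs x; have [w hw w1] := hs y.
have := normr_dot_le_enorm _ (x - y) v1.
have := normr_dot_le_enorm _ (x - y) w1.
have := hv y; have := hw x.
rewrite -(opprB x y) dotNr !ler_norml; lra.
Qed.

Lemma lipschitz_continuous : lipschitz_over 1 setT h -> continuous h.
Proof.
move=> hl x; apply/(@cvgrPdist_lt _ R^o _ _ (nbhs_filter x)) => e e0.
(* Neighbourhoods come from the sup norm; continuity of the squared Euclidean distance to [x] links
   the two norms. *)
have ce := @continuous_dotB R n x x.
have e2 : 0 < e ^+ 2 by rewrite exprn_gt0.
move/(@cvgrPdist_lt _ R^o _ _ (nbhs_filter x))/(_ _ e2): ce; apply: filterS => y /=.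
rewrite subrr dot0l sub0r normrN ger0_norm ?dot_ge0// => dy.
apply: le_lt_trans (hl x y I I) _.
rewrite mul1r -(opprB y x) enormN /enorm -(ltr_pXn2r (n:=2)) ?nnegrE//.
  by rewrite sqr_sqrtr ?dot_ge0.
exact: ltW.
Qed.

End Subgradient.

(** * The Euclidean ball used as feasible set *)

Section EuclideanBall.
Context {R : realType} {n : nat} (x0 : 'rV[R]_n) (rho : R).

(* Radius squared, to spare a square root. *)
Definition eball : set 'rV[R]_n := [set x | dot (x - x0) (x - x0) <= rho].

Lemma eball_convex : convex_set eball.
Proof.
move=> x y t; rewrite !inE => xZ yZ; rewrite /eball /=.
have {}xZ : dot ((x : 'rV[R]_n) - x0) (x - x0) <= rho := xZ.
have {}yZ : dot ((y : 'rV[R]_n) - x0) (y - x0) <= rho := yZ.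
set z := conv t x y.
have zE : z = t%:num *: (x : 'rV[R]_n) + (1 - t%:num) *: (y : 'rV[R]_n) by [].
have t0 : 0 <= t%:num by [].
have t1 : t%:num <= 1 by [].
have -> : z - x0 = t%:num *: (x - x0) + (1 - t%:num) *: (y - x0).
  rewrite zE !scalerBr addrACA -opprD -scalerDl (_ : _ + (1 - _) = 1) ?scale1r//.
  by ring.
(* With p, q the two displacements, |sp + (1-s)q|^2 = s|p|^2 + (1-s)|q|^2 - s(1-s)|p-q|^2. *)
have := dot_ge0 ((x - x0) - (y - x0)).
move: (x - x0) (y - x0) (t%:num) t0 t1 xZ yZ => p q s s0 s1 pr qr.
rewrite dotBl !dotBr !dotDl !dotDr !dotZl !dotZr (dotC q p) => pq.
have s1' : 0 <= 1 - s by rewrite subr_ge0.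
have := mulr_ge0 (mulr_ge0 s0 s1') pq.
have := ler_wpM2l s0 pr; have := ler_wpM2l s1' qr.
lra.
Qed.

Lemma eball_compact : compact eball.
Proof.
(* If t^2 <= rho then 2|t| <= t^2 + 1 <= rho + 1, so this box contains the ball. *)
pose box i : set R := `[x0 0 i - (rho + 1), x0 0 i + (rho + 1)]%classic.
have boxc : compact [set x : 'rV[R]_n | forall i, box i (x 0 i)].
  by apply: (@rV_compact _ _ box) => i; exact: segment_compact.
apply: subclosed_compact boxc _ => [|x xZ i].
  change (closed ((fun x : 'rV[R]_n => dot (x - x0) (x - x0)) @^-1`
    [set r : R | r <= rho])).
  apply: preimage_closed; last exact: closed_le.
  by move=> x _; exact: continuous_dotB.
have := sqr_coord_le_dot (x - x0) i; rewrite !mxE => xi.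
have := le_trans xi xZ; rewrite /box /= in_itv /= => xr.
have := sqr_ge0 (x 0 i - x0 0 i - 1); have := sqr_ge0 (x 0 i - x0 0 i + 1).
by move=> ? ?; apply/andP; split; nra.
Qed.

End EuclideanBall.

(** * Least index attaining a maximum *)

Section FirstMax.
Context {R : realType} {m : nat}.
Implicit Type h : 'I_m.+1 -> R.

(** Taking the least maximizer breaks ties in favour of directions already fixed. The inner
    [arg max] only witnesses that a maximizer exists. *)
Definition first_max h : 'I_m.+1 :=
  [arg min_(j < [arg max_(i > ord0) h i]%O | [forall i, h i <= h j]) (j : nat)].

Lemma first_maxP h : (forall i, h i <= h (first_max h)) /\
  (forall j, (forall i, h i <= h j) -> (first_max h <= j)%N).
Proof.
rewrite /first_max; case: arg_minnP => [|j /forallP hj jmin].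
  by case: arg_maxP => // i _ hi; apply/forallP => j; exact: hi.
by split=> // k hk; apply: jmin; apply/forallP.
Qed.

End FirstMax.

(** * The objectives, their adversarial subgradients and the solution *)

Section ResistingOracle.
Context {R : realType} (T : nat) {n : nat} (x0 : 'rV[R]_n).
Implicit Types (v w : 'I_T.+1 -> 'rV[R]_n) (x : 'rV[R]_n) (j : 'I_T.+1).

(** For orthonormal directions, minus the optimal lower-level value. *)
Definition height : R := (2 * T.+1%:R)^-1.

(* Coordinates of the solution, relative to [x0], in the basis [v]: the lower
   weight in the last direction makes its last coordinate of constant order. *)
Definition opt_coord j : R := if j == ord_max then 2^-1 else height.

Definition weight j : R := height / opt_coord j.

(** For orthonormal directions, the squared distance from [x0] to the solution, which thus lies on
    the sphere. *)
Definition sqr_radius : R := \sum_j opt_coord j ^+ 2.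

Definition piece v x j : R := - (weight j * dot (v j) (x - x0)).

Definition max_pieces v x : R := piece v x (first_max (piece v x)).

Definition last_direction v x : R := Num.max 0 (dot (v ord_max) (x - x0)).

(** At the kink of [last_direction] the answer is 0, so the upper level reveals [v ord_max] only
    once it is strictly positive. *)
Definition resisting_oracle v x : 'rV[R]_n * 'rV[R]_n :=
  (if 0 < dot (v ord_max) (x - x0) then v ord_max else 0,
   - (weight (first_max (piece v x)) *: v (first_max (piece v x)))).

Definition opt_point v : 'rV[R]_n := x0 + \sum_j opt_coord j *: v j.

Lemma height_gt0 : 0 < height.
Proof. by rewrite invr_gt0 mulr_gt0 ?ltr0n. Qed.

Lemma height_le_half : height <= 2^-1.
Proof.
rewrite /height invfM ler_piMr ?invr_ge0//.
by rewrite invf_le1 ?ltr0n// ler1n.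
Qed.

Lemma height_le_opt_coord j : height <= opt_coord j.
Proof. by rewrite /opt_coord; case: ifP => // _; exact: height_le_half. Qed.

Lemma opt_coord_gt0 j : 0 < opt_coord j.
Proof. exact: lt_le_trans height_gt0 (height_le_opt_coord j). Qed.

Lemma weight_opt_coord j : weight j * opt_coord j = height.
Proof. by rewrite divfK// gt_eqF ?opt_coord_gt0. Qed.

Lemma weight_gt0 j : 0 < weight j.
Proof. by rewrite divr_gt0 ?height_gt0 ?opt_coord_gt0. Qed.

Lemma weight_le1 j : weight j <= 1.
Proof. by rewrite ler_pdivrMr ?opt_coord_gt0// mul1r height_le_opt_coord. Qed.

(** The last coordinate contributes 1/4, the others at most [height ^+ 2 *+ T.+1], which is
    [height / 2]. *)
Lemma sqr_radius_le1 : sqr_radius <= 1.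
Proof.
rewrite /sqr_radius (bigD1 ord_max) //= {1}/opt_coord eqxx.
have -> : \sum_(i < T.+1 | i != ord_max) opt_coord i ^+ 2 =
    \sum_(i < T.+1 | i != ord_max) height ^+ 2.
  by apply: eq_bigr => i /negPf imax; rewrite /opt_coord imax.
have le_all : \sum_(i < T.+1 | i != ord_max) height ^+ 2 <=
    \sum_(i < T.+1) height ^+ 2.
  by rewrite [leRHS](bigD1 ord_max) //= lerDr sqr_ge0.
move: le_all; rewrite [leRHS]sumr_const card_ord.
have hT : height * T.+1%:R = 2^-1.
  by rewrite /height invfM -mulrA mulVf ?mulr1// pnatr_eq0.
have -> : height ^+ 2 *+ T.+1 = height / 2.
  by rewrite -mulr_natr expr2 -mulrA hT.
have := height_le_half; lra.
Qed.

Lemma piece_le_max v x j : piece v x j <= max_pieces v x.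
Proof. by have [+ _] := first_maxP (piece v x); apply. Qed.

Lemma resisting_oracle_upper v x :
  subgradient (last_direction v) x (resisting_oracle v x).1.
Proof.
move=> y; rewrite /last_direction /=.
have -> : dot (v ord_max) (y - x0) =
    dot (v ord_max) (x - x0) + dot (v ord_max) (y - x).
  by rewrite -dotDr [x - x0 + _]addrC addrA subrK.
set a := dot _ (x - x0).
case: ltP => a0; first by rewrite le_max lexx orbT.
by rewrite dot0l addr0 le_max lexx.
Qed.

Lemma resisting_oracle_lower v x :
  subgradient (max_pieces v) x (resisting_oracle v x).2.
Proof.
move=> y; rewrite {1}/max_pieces /=; set j := first_max _.
apply: le_trans (piece_le_max v y j).
rewrite /piece dotNl dotZl !dotBr; lra.
Qed.

Lemma opt_point_piece v j :
  (forall i k, dot (v i) (v k) = (i == k)%:R) ->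
  dot (v j) (opt_point v - x0) = opt_coord j.
Proof.
move=> ov; rewrite /opt_point addrC addKr dot_sumr (bigD1 j) //= big1.
  by rewrite dotZr ov eqxx mulr1 addr0.
by move=> i ij; rewrite dotZr ov eq_sym (negPf ij) mulr0.
Qed.

(* On the ball, [max_pieces v x <= - height] forces every coordinate of
   [x - x0] to reach that of the solution, which uses up the whole radius. *)
Lemma max_pieces_unique v x :
  (forall i k, dot (v i) (v k) = (i == k)%:R) ->
  eball x0 sqr_radius x -> max_pieces v x <= - height -> x = opt_point v.
Proof.
move=> ov xZ gx.
have coord_ge j : opt_coord j <= dot (v j) (x - x0).
  rewrite -(ler_pM2l (weight_gt0 j)) weight_opt_coord.
  by have := le_trans (piece_le_max v x j) gx; rewrite lerN2.
set p := opt_point v - x0.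
have pE : p = \sum_j opt_coord j *: v j by rewrite /p /opt_point addrC addKr.
have pp : dot p p = sqr_radius.
  rewrite {2}pE dot_sumr; apply: eq_bigr => j _.
  by rewrite dotZr dotC opt_point_piece.
have px : sqr_radius <= dot p (x - x0).
  rewrite dotC pE dot_sumr; apply: ler_sum => j _.
  by rewrite dotZr expr2 ler_pM2l ?opt_coord_gt0// dotC.
have xx : dot (x - x0) (x - x0) <= sqr_radius := xZ.
have : x - x0 - p = 0.
  apply: dot_eq0; move: (x - x0) p px xx {pE} pp => d q qd dd qq.
  by rewrite dotBl !dotBr (dotC d q); lra.
by rewrite /p opprB addrA subrK => /eqP; rewrite subr_eq0 => /eqP.
Qed.

(* At a point on which the directions from [i] on vanish, the first maximal
   piece has index at most [i]; the answer does not reveal later directions. *)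
Lemma resisting_oracle_local v w x (i : 'I_T.+1) :
  (forall j, dot (w j) (x - x0) = dot (v j) (x - x0)) ->
  (forall j, (i <= j)%N -> dot (v j) (x - x0) = 0) ->
  (forall j, (j <= i)%N -> w j = v j) ->
  resisting_oracle w x = resisting_oracle v x.
Proof.
move=> wv v0 wvi; rewrite /resisting_oracle.
have -> : piece w x = piece v x by apply/funext => j; rewrite /piece wv.
rewrite wv (v0 ord_max (leq_ord i)) ltxx; congr (_, - (_ *: _)); apply: wvi.
have [fm fmin] := first_maxP (piece v x).
rewrite leqNgt; apply/negP => lt_i.
suff zero j : (i <= j)%N -> piece v x j = 0.
  suff : (first_max (piece v x) <= i)%N by rewrite leqNgt lt_i.
  by apply: fmin => j; rewrite (le_trans (fm j))// !zero// ltnW.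
by move=> ij; rewrite /piece v0// mulr0 oppr0.
Qed.

(** * Choosing the directions against the algorithm *)

Section Directions.
Variable A : algorithm R.
Let Z := eball x0 sqr_radius.
Let point v k := test_point A Z x0 (answers A Z x0 (resisting_oracle v) k).

(** Induction on the number of directions fixed, with zero vectors standing for those still to
    come. *)
Lemma exists_partial_directions k : (T.+1 + T.+1 < n)%N -> (k <= T.+1)%N ->
  exists v, [/\ forall i j, dot (v i) (v j) = ((i == j) && (i < k)%N)%:R,
    forall j, (k <= j)%N -> v j = 0 &
    forall i j, (i <= j)%N -> dot (v j) (point v i - x0) = 0].
Proof.
move=> ltn; elim: k => [_|k IH kT].
  exists (fun=> 0); split=> // [i j|i j _]; last by rewrite dot0l.
  by rewrite dot0l ltn0 andbF.
have [v [ov v0 pv]] := IH (ltnW kT).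
(* The rows are [T.+1] directions and [T.+1] displacements of test points, whence the dimension
   bound. *)
have [u uu uM] := @exists_unit_orthogonal R _ _
  (col_mx (\matrix_(j < T.+1) v j)
          (\matrix_(i < T.+1) (point v i - x0))) ltn.
have uv j : dot u (v j) = 0.
  by have := uM (lshift _ j); rewrite rowKu rowK.
have up i : (i <= k)%N -> dot u (point v i - x0) = 0.
  move=> ik; have iT : (i < T.+1)%N := leq_ltn_trans ik kT.
  by have := uM (rshift _ (Ordinal iT)); rewrite rowKd rowK.
pose K := Ordinal kT; pose w j := if j == K then u else v j.
have vK : v K = 0 by apply: v0.
have wK : w K = u by rewrite /w eqxx.
have wE j : j != K -> w j = v j by rewrite /w => /negPf ->.
(* Replacing the zero at index [k] by [u] changes no answer before step [k], so [u] is still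
   orthogonal to the displacements of the new run up to point [k]. *)
have same i : (i <= k)%N -> answers A Z x0 (resisting_oracle w) i =
    answers A Z x0 (resisting_oracle v) i.
  elim: i => // i IHi ik /=; rewrite IHi ?(ltnW ik)//; congr rcons.
  have iT : (i < T.+1)%N := ltn_trans ik kT.
  apply: (resisting_oracle_local _ _ _ (Ordinal iT)) => j /=.
  - have [->|/wE -> //] := eqVneq j K.
    by rewrite wK vK dot0l up ?(ltnW ik).
  - exact: pv.
  - by move=> ji; apply: wE; rewrite -val_eqE /= neq_ltn (leq_ltn_trans ji ik).
have samep i : (i <= k)%N -> point w i = point v i.
  by move=> ik; rewrite /point same.
exists w; split=> [i j|j kj|i j ij].
- have [->|iK] := eqVneq i K; have [->|jK] := eqVneq j K.
  + by rewrite wK uu ltnSn.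
  + by rewrite wK wE// uv.
  + by rewrite wK wE// dotC uv (negPf iK).
  + rewrite !wE// ov ltnS [in RHS]leq_eqVlt.
    by move: iK; rewrite -val_eqE /= => /negPf ->.
- by rewrite wE ?v0 1?ltnW// -val_eqE /= neq_ltn kj orbT.
- have [jK|jK] := eqVneq j K.
    by rewrite jK wK; move: ij; rewrite jK => ij; rewrite samep// up.
  rewrite wE//; have [kj|jk] := leqP k j; first by rewrite v0// dot0l.
  by rewrite samep ?pv// (leq_trans ij)// ltnW.
Qed.

Lemma exists_directions : (T.+1 + T.+1 < n)%N ->
  exists v, (forall i j, dot (v i) (v j) = (i == j)%:R) /\
    forall k, (k <= T)%N -> dot (v ord_max) (point v k - x0) = 0.
Proof.
move=> Tn; have [v [ov _ pv]] := exists_partial_directions T.+1 Tn (leqnn _).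
exists v; split=> [i j|k kT]; last exact: pv.
by rewrite ov ltn_ord andbT.
Qed.

End Directions.

End ResistingOracle.

(** * The hard instance and its unique solution *)

Section HardInstance.
Context {R : realType} (T : nat) {n : nat} (x0 : 'rV[R]_n).
Context (v : 'I_T.+1 -> 'rV[R]_n).
Hypothesis ov : forall i j, dot (v i) (v j) = (i == j)%:R.

Let f := last_direction T x0 v.
Let g := max_pieces T x0 v.
Let Z := eball x0 (sqr_radius T).
Let O := resisting_oracle T x0 v.

Lemma upper_short_subgradient x : exists2 s, subgradient f x s & dot s s <= 1.
Proof.
exists (O x).1; first exact: resisting_oracle_upper.
by rewrite /=; case: ifP => _; rewrite ?dot0l// ov eqxx.
Qed.

Lemma lower_short_subgradient x : exists2 s, subgradient g x s & dot s s <= 1.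
Proof.
exists (O x).2; first exact: resisting_oracle_lower.
rewrite /= dotNl dotNr opprK dotZl dotZr ov eqxx mulr1.
by rewrite mulr_ile1 ?weight_le1// ltW ?weight_gt0.
Qed.

Definition hard_instance : bilevel R.
Proof.
refine (@Bilevel R n f g Z _ _ _ _ (eball_convex _ _) (eball_compact _ _)).
- apply: subgradient_convex => x.
  by have [s fs _] := upper_short_subgradient x; exists s.
- apply: lipschitz_continuous; apply: subgradient_lipschitz.
  exact: upper_short_subgradient.
- apply: subgradient_convex => x.
  by have [s gs _] := lower_short_subgradient x; exists s.
- apply: lipschitz_continuous; apply: subgradient_lipschitz.
  exact: lower_short_subgradient.
Defined.

Lemma hard_instance_lipschitz : lipschitz_instance 1 1 hard_instance.
Proof.
split; apply: subgradient_lipschitz.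
  exact: upper_short_subgradient.
exact: lower_short_subgradient.
Qed.

Lemma opt_point_dist :
  dot (opt_point T x0 v - x0) (opt_point T x0 v - x0) = sqr_radius T.
Proof.
rewrite {2}/opt_point [x0 + _]addrC addrK dot_sumr; apply: eq_bigr => j _.
by rewrite dotZr dotC opt_point_piece.
Qed.

Lemma max_pieces_opt_point : g (opt_point T x0 v) = - height T.
Proof. by rewrite /g /max_pieces /piece opt_point_piece// weight_opt_coord. Qed.

(** Uniqueness at level [- height] gives minimality too: a point with a smaller value would coincide
    with [opt_point]. *)
Lemma lower_solutions_hard :
  lower_solutions hard_instance = [set opt_point T x0 v].
Proof.
have optZ : Z (opt_point T x0 v) by rewrite /Z /eball /= opt_point_dist.
apply/seteqP; split=> [x [xZ xmin]|_ ->] /=.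
  apply: max_pieces_unique => //.
  by rewrite -max_pieces_opt_point; exact: xmin.
split=> // z zZ; change (g (opt_point T x0 v) <= g z).
rewrite leNgt; apply/negP => lt_g.
have zopt : z = opt_point T x0 v.
  apply: max_pieces_unique => //.
  by rewrite -max_pieces_opt_point; exact: ltW.
by rewrite zopt ltxx in lt_g.
Qed.

Lemma optimal_solutions_hard :
  optimal_solutions hard_instance = [set opt_point T x0 v].
Proof.
rewrite /optimal_solutions lower_solutions_hard.
by apply/seteqP; split=> [x [] //|_ ->]; split=> // z ->.
Qed.

Lemma last_direction_opt_point : f (opt_point T x0 v) = 2^-1.
Proof.
rewrite /f /last_direction opt_point_piece// /opt_coord eqxx.
by rewrite max_r ?invr_ge0.
Qed.

Lemma optimal_value_hard : optimal_value hard_instance = 2^-1.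
Proof.
rewrite /optimal_value lower_solutions_hard image_set1 inf1.
exact: last_direction_opt_point.
Qed.

End HardInstance.

(* The dimension is part of the instance, hence an initial point is given in
   every dimension: the one used is that of the dimension of the instance. *)
Theorem theorem4p2 (R : realType) (A : algorithm R) (T : nat)
    (x0 : forall n : nat, 'rV[R]_n) :
  zero_respecting A ->
  exists (P : bilevel R)
         (O : 'rV[R]_(ndim P) -> 'rV[R]_(ndim P) * 'rV[R]_(ndim P)),
    [/\ lipschitz_instance 1 1 P,
        is_oracle O,
        exists2 xstar : 'rV[R]_(ndim P),
          optimal_solutions P = [set xstar] &
          enorm (x0 (ndim P) - xstar) <= 1,
        1 / 4 <= `|upper_obj P (x0 (ndim P)) - optimal_value P| &
        forall k : nat, (1 <= k <= T)%N ->
          upper_obj P (iterate A (x0 (ndim P)) O k) =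
          upper_obj P (x0 (ndim P))].
Proof.
(* The least dimension that [exists_directions] allows. *)
move=> _; set n := (T.+1 + T.+1).+1.
have [v [ov pv]] := exists_directions T (x0 n) A (ltnSn _).
have fx0 : last_direction T (x0 n) v (x0 n) = 0.
  by rewrite /last_direction subrr dot0r maxxx.
exists (hard_instance T (x0 n) v ov), (resisting_oracle T (x0 n) v); split.
- exact: hard_instance_lipschitz.
- by move=> x; split;
    [exact: resisting_oracle_upper|exact: resisting_oracle_lower].
- exists (opt_point T (x0 n) v); first exact: optimal_solutions_hard.
  rewrite -enormN opprB /enorm opt_point_dist//.
  by rewrite -[leRHS]sqrtr1 ler_sqrt// sqr_radius_le1.
(* The gap is exactly 1/2. *)
- rewrite optimal_value_hard /= fx0 sub0r normrN ger0_norm ?invr_ge0//; lra.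
- move=> k /andP[_ kT]; rewrite /= fx0.
  by rewrite /last_direction pv// maxxx.
Qed.
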